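(* The set $Z$ is inner approximated by $Z_I$, i.e. $Z_I\subseteq Z$, where $Z_I$ is the set of all $x\in\mathbb{R}^n$ for which there exists $\alpha$ with $0\le\alpha<\epsilon$ such that $$\mathbb{P}_{\tilde\zeta}\left\{\frac{\delta}{\epsilon-\alpha}\|a(x)\|_*+a(x)^\top\tilde\zeta_i\le b_i(x),\ \forall i\in[I]\right\}\ge1-\alpha.$$
   Context: Let $n,I,N$ be positive integers, $[R]:=\{1,\dots,R\}$, $\epsilon\in(0,1)$, $\delta>0$. Let $\eta_1,\eta_2\in\{0,1\}$ with $\eta_1+\eta_2\ge1$. For $x\in\mathbb{R}^n$ let $a(x)=\begin{pmatrix}\eta_1x\\ \eta_2\end{pmatrix}\in\mathbb{R}^{n+1}$ and, for $i\in[I]$, $b_i(x)=B_i^\top x+b^i$ with given $B_i\in\mathbb{R}^n$, $b^i\in\mathbb{R}$. The uncertain parameter $\xi=(\xi_1,\dots,\xi_I)$, $\xi_i\in\mathbb{R}^{n+1}$, takes values in $\Xi=\mathbb{R}^{I\times(n+1)}$, equipped with a norm $\|\cdot\|$. For $a\in\mathbb{R}^{n+1}$ the dual norm is $\|a\|_*=\sup\{a^\top u_i:\ u=(u_1,\dots,u_I)\in\Xi,\ \|u\|\le1\}$, where the norm is such that this value does not depend on $i\in[I]$ (as for any $L_p$ norm). Samples $\zeta^1,\dots,\zeta^N\in\Xi$, $\zeta^j=(\zeta^j_1,\dots,\zeta^j_I)$, are given (realizations of i.i.d. samples from a true distribution); the random vector $\tilde\zeta=(\tilde\zeta_1,\dots,\tilde\zeta_I)$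 has the empirical distribution $\mathbb{P}_{\tilde\zeta}$, which gives mass $1/N$ to each $\zeta^j$, $j\in[N]$. The Wasserstein distance of probability distributions on $\Xi$ is $$W(\mathbb{P}_1,\mathbb{P}_2)=\inf\left\{\int_{\Xi\times\Xi}\|\xi_1-\xi_2\|\,\mathbb{Q}(d\xi_1,d\xi_2):\ \mathbb{Q}\text{ a joint distribution with marginals }\mathbb{P}_1,\mathbb{P}_2\right\},$$ and the ambiguity set is $\mathcal{P}=\{\mathbb{P}:\ \mathbb{P}\{\tilde\xi\in\Xi\}=1,\ W(\mathbb{P},\mathbb{P}_{\tilde\zeta})\le\delta\}$. Define $$Z=\left\{x\in\mathbb{R}^n:\ \inf_{\mathbb{P}\in\mathcal{P}}\mathbb{P}\left\{\tilde\xi:\ a(x)^\top\tilde\xi_i\le b_i(x),\ \forall i\in[I]\right\}\ge1-\epsilon\right\}.$$ *)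

(* Defs.v *)
From HB Require Import structures.
From mathcomp Require Import all_boot all_order all_algebra.
From mathcomp Require Import all_classical all_reals all_analysis.

Set Implicit Arguments.
Unset Strict Implicit.
Unset Printing Implicit Defensive.

Import Order.TTheory GRing.Theory Num.Theory.
Import numFieldNormedType.Exports.

Local Open Scope classical_set_scope.
Local Open Scope ring_scope.

(* The space R^(m x (n+1)) of the uncertain parameter xi = (xi_1, ..., xi_m)
   with its Borel sigma-algebra; xi_i is the i-th row of xi, so that
   a^T xi_i is (xi *m a) i 0 for a column vector a. *)
Notation Xi R m n := (g_sigma_algebraType (@open 'M[R]_(m, n + 1))).

(* An arbitrary norm, not the max norm that matrices carry canonically. All
   norms on this space induce the same topology, hence the same Borel sets. *)
Record is_norm (R : realType) (m n : nat)
    (nrm : 'M[R]_(m, n + 1) -> R) : Prop := IsNorm {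
    is_norm_ler_normD : forall u v, nrm (u + v) <= nrm u + nrm v;
    is_norm_scale : forall (c : R) u, nrm (c *: u) = `|c| * nrm u;
    is_norm_eq0 : forall u, nrm u = 0 -> u = 0 }.

Definition dual_norm_at (R : realType) (m n : nat)
    (nrm : 'M[R]_(m, n + 1) -> R) (i : 'I_m) (a : 'cV[R]_(n + 1)) : R :=
  sup [set (u *m a) i 0 | u in [set u | nrm u <= 1]].

(* The value at the first block; it is the dual norm under the standing
   assumption that dual_norm_at nrm i does not depend on i. *)
Definition dual_norm (R : realType) (m n : nat) (hm : (0 < m)%N)
    (nrm : 'M[R]_(m, n + 1) -> R) (a : 'cV[R]_(n + 1)) : R :=
  dual_norm_at nrm (Ordinal hm) a.

Section empirical.
Local Open Scope ereal_scope.
Context d (T : measurableType d) (R : realType) (N : nat).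

(* The hypothesis 0 < N is needed for this to be a probability measure. *)
Definition empirical (_ : (0 < N)%N) (zeta : 'I_N -> T) (A : set T) : \bar R :=
  (N%:R^-1)%:E * \sum_(j < N) \d_(zeta j) A.

Variables (hN : (0 < N)%N) (zeta : 'I_N -> T).

Let emp0 : empirical hN zeta set0 = 0.
Proof. by rewrite /empirical big1 ?mule0// => j _; rewrite measure0. Qed.

Let emp_ge0 A : 0 <= empirical hN zeta A.
Proof.
rewrite /empirical mule_ge0// ?lee_fin ?invr_ge0//.
by apply: sume_ge0 => j _.
Qed.

Let emp_sigma_additive : semi_sigma_additive (empirical hN zeta).
Proof.
move=> F mF tF mUF.
pose S k := \sum_(j < N) (\sum_(0 <= i < k) (\d_(zeta j) (F i) : \bar R)).
have -> : (fun k => \sum_(0 <= i < k) empirical hN zeta (F i)) =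
    (fun k => (N%:R^-1)%:E * S k).
  apply/funext => k; rewrite /S /empirical exchange_big/=.
  by rewrite ge0_sume_distrr// => i _; apply: sume_ge0.
apply: cvgeZl => //; rewrite /S.
apply: cvg_nnesum => j _; last exact: measure_semi_sigma_additive.
by apply: nearW => k; exact: sume_ge0.
Qed.

HB.instance Definition _ := isMeasure.Build _ T R (empirical hN zeta)
  emp0 emp_ge0 emp_sigma_additive.

Let emp_setT : empirical hN zeta setT = 1.
Proof.
rewrite /empirical (eq_bigr (fun=> 1)) => [|j _]; last by rewrite diracT.
rewrite sumEFin big_const_ord iter_addr_0 -EFinM mulVf//.
by rewrite pnatr_eq0 -lt0n.
Qed.

HB.instance Definition _ :=
  Measure_isProbability.Build _ T R (empirical hN zeta) emp_setT.

End empirical.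

Arguments empirical {d T} R {N} hN zeta A.

Definition coupling d (T : measurableType d) (R : realType)
    (P1 P2 : probability T R) : set (probability (T * T)%type R) :=
  [set Q | (forall A, measurable A -> Q (fst @^-1` A) = P1 A) /\
           (forall A, measurable A -> Q (snd @^-1` A) = P2 A)].

Definition wasserstein (R : realType) (m n : nat)
    (nrm : 'M[R]_(m, n + 1) -> R) (P1 P2 : probability (Xi R m n) R) : \bar R :=
  ereal_inf [set (\int[Q]_z (nrm ((z.1 : 'M[R]_(m, n + 1)) - z.2))%:E)%E
            | Q in coupling P1 P2].

Definition ambiguity_set (R : realType) (m n N : nat) (hN : (0 < N)%N)
    (nrm : 'M[R]_(m, n + 1) -> R) (delta : R) (zeta : 'I_N -> Xi R m n) :
    set (probability (Xi R m n) R) :=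
  [set P : probability (Xi R m n) R | P setT = 1%E /\
           (wasserstein nrm P (empirical R hN zeta) <= delta%:E)%E].

Definition avec (R : realType) (n : nat) (eta1 eta2 : bool) (x : 'cV[R]_n) :
    'cV[R]_(n + 1) :=
  col_mx (eta1%:R *: x) (eta2%:R)%:M.

Definition bfun (R : realType) (m n : nat) (B : 'I_m -> 'cV[R]_n)
    (b : 'I_m -> R) (i : 'I_m) (x : 'cV[R]_n) : R :=
  ((B i)^T *m x) 0 0 + b i.

Definition Zset (R : realType) (m n N : nat) (hN : (0 < N)%N)
    (nrm : 'M[R]_(m, n + 1) -> R) (eps delta : R) (zeta : 'I_N -> Xi R m n)
    (eta1 eta2 : bool) (B : 'I_m -> 'cV[R]_n) (b : 'I_m -> R) :
    set 'cV[R]_n :=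
  [set x | ((1 - eps)%:E <=
    ereal_inf [set (P : probability (Xi R m n) R)
                     [set xi : Xi R m n | forall i,
                        (((xi : 'M[R]_(m, n + 1)) *m avec eta1 eta2 x) i 0
                          <= bfun B b i x)%R]
              | P in ambiguity_set hN nrm delta zeta])%E].

Definition ZIset (R : realType) (m n N : nat) (hm : (0 < m)%N) (hN : (0 < N)%N)
    (nrm : 'M[R]_(m, n + 1) -> R) (eps delta : R) (zeta : 'I_N -> Xi R m n)
    (eta1 eta2 : bool) (B : 'I_m -> 'cV[R]_n) (b : 'I_m -> R) :
    set 'cV[R]_n :=
  [set x | exists alpha : R, [/\ 0 <= alpha, alpha < eps &
    ((1 - alpha)%:E <=
      empirical R hN zeta
        [set z : Xi R m n | forall i,
           (delta / (eps - alpha) * dual_norm hm nrm (avec eta1 eta2 x)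
             + ((z : 'M[R]_(m, n + 1)) *m avec eta1 eta2 x) i 0
           <= bfun B b i x)%R])%E]].

(* Main.v *)
Require Import Defs.
From mathcomp Require Import all_boot all_order all_algebra.
From mathcomp Require Import all_classical all_reals all_analysis.
From mathcomp Require Import lra.

(** Why the theorem is true.  Write [theta = eps - alpha], [r = delta / theta],
    let [S] be the safe set of [x] (all constraints hold) and [G] the set of
    points that satisfy every constraint with the margin [r * ||a(x)||_*].

    A point [u] outside [S] violates some constraint [i], while [v] in [G]
    satisfies it with the margin, so [a(x)^T (u_i - v_i) > r ||a(x)||_*].  The
    dual norm inequality [a^T w_i <= ||a||_* ||w||] ([mulmx_le_dual_norm_at])
    then gives [||u - v|| >= r] (in the degenerate case [||a(x)||_* = 0] no such pair
    exists): unsafe points lie at distance at least [r] from [G].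

    Hence any transport plan from [P] to the empirical distribution must carry
    at distance [r] or more all the mass of [G] that is not matched with [S],
    which is at least [Pemp G - P S].  So
    [r * (Pemp G - P S) <= W(P, Pemp) <= delta = r * theta]
    ([wasserstein_ge_separated]), and [Pemp G >= 1 - alpha] yields
    [P S >= 1 - alpha - theta = 1 - eps].

    The dual norm is defined as a real supremum, which is meaningful only for a
    set that is bounded above; that the unit ball of an arbitrary norm is
    bounded is the finite-dimensional comparison of norms
    ([is_norm_dominates_entries]), obtained from compactness of the unit
    sphere of the max norm. *)

Import Order.TTheory GRing.Theory Num.Theory.
Import numFieldNormedType.Exports.

Local Open Scope classical_set_scope.
Local Open Scope ring_scope.

Set Implicit Arguments.
Unset Strict Implicit.
Unset Printing Implicit Defensive.

Lemma is_norm_0 (R : realType) (m n : nat) (nrm : 'M[R]_(m, n + 1) -> R) :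
  is_norm nrm -> nrm 0 = 0.
Proof. by move=> hnrm; rewrite -(scale0r 0) (is_norm_scale hnrm) normr0 mul0r. Qed.

Lemma is_normN (R : realType) (m n : nat) (nrm : 'M[R]_(m, n + 1) -> R) u :
  is_norm nrm -> nrm (- u) = nrm u.
Proof. by move=> hnrm; rewrite -scaleN1r (is_norm_scale hnrm) normrN1 mul1r. Qed.

Lemma is_norm_ge0 (R : realType) (m n : nat) (nrm : 'M[R]_(m, n + 1) -> R) u :
  is_norm nrm -> 0 <= nrm u.
Proof.
move=> hnrm; have := is_norm_ler_normD hnrm u (- u).
by rewrite subrr (is_norm_0 hnrm) (is_normN _ hnrm) -mulr2n pmulrn_lge0.
Qed.

Lemma is_norm_sum (R : realType) (m n : nat) (nrm : 'M[R]_(m, n + 1) -> R)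
    (I : Type) (s : seq I) (F : I -> 'M[R]_(m, n + 1)) :
  is_norm nrm -> nrm (\sum_(i <- s) F i) <= \sum_(i <- s) nrm (F i).
Proof.
move=> hnrm; elim/big_ind2 : _ => [|s1 u s2 v us vs|//].
  by rewrite (is_norm_0 hnrm).
exact: le_trans (is_norm_ler_normD hnrm u v) (lerD us vs).
Qed.

Lemma ler_coord_mx_norm (R : realType) (m n : nat) (u : 'M[R]_(m, n)) i j :
  `|u i j| <= `|u|.
Proof.
rewrite [leRHS]/Num.norm /= mx_normrE.
by apply: (le_bigmax _ (fun ij : 'I_m * 'I_n => `|u ij.1 ij.2|) (i, j)).
Qed.

(** A norm is Lipschitz for the max norm, because it is controlled by its
    values on the canonical basis.  Matrices are read through [vec_mx] as row
    vectors, for which closed bounded sets are known to be compact. *)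
Lemma is_norm_vec_mx_continuous (R : realType) (m n : nat)
    (nrm : 'M[R]_(m, n + 1) -> R) :
  is_norm nrm -> continuous (fun v : 'rV[R]_(m * (n + 1)) => nrm (vec_mx v)).
Proof.
move=> hnrm.
(* The summand 1 keeps the Lipschitz constant positive, also in dimension 0. *)
pose C := \sum_(k < m * (n + 1)) nrm (vec_mx (delta_mx 0 k)) + 1.
have C0 : 0 < C.
  by rewrite ltr_pwDr// sumr_ge0// => k _; exact: is_norm_ge0.
have leC (v : 'rV[R]_(m * (n + 1))) : nrm (vec_mx v) <= C * `|v|.
  rewrite {1}(row_sum_delta v) linear_sum.
  apply: le_trans (is_norm_sum _ _ hnrm) _.
  rewrite mulrDl mul1r mulr_suml ler_wpDr// ler_sum// => k _.
  rewrite linearZ (is_norm_scale hnrm) mulrC.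
  by rewrite ler_wpM2l ?ler_coord_mx_norm//; exact: is_norm_ge0.
have lip (v w : 'rV[R]_(m * (n + 1))) :
    nrm (vec_mx v) - nrm (vec_mx w) <= C * `|v - w|.
  rewrite lerBlDr; apply: le_trans (lerD (leC _) (lexx _)).
  by rewrite linearB -[in leLHS](subrK (vec_mx w) (vec_mx v)) is_norm_ler_normD.
move=> v; apply/(@cvgrPdist_le _ _ _ (nbhs v)) => e e0.
have Ce0 : 0 < C^-1 * e by rewrite mulr_gt0 ?invr_gt0.
apply: filterS (nbhsx_ballx v _ Ce0) => w; rewrite -ball_normE /= => /ltW vw.
apply: (@le_trans _ _ (C * `|v - w|)); last by rewrite -ler_pdivlMl.
by rewrite ler_norml lip andbT lerNl opprB distrC lip.
Qed.

(** On the compact unit sphere of the max norm the continuous function [nrm]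
    attains its minimum, which is positive by definiteness; homogeneity extends
    the comparison to the whole space. *)
Lemma is_norm_dominates_entries (R : realType) (m n : nat)
    (nrm : 'M[R]_(m, n + 1) -> R) :
  is_norm nrm ->
  exists2 c : R, 0 < c & forall (u : 'M[R]_(m, n + 1)) i j, c * `|u i j| <= nrm u.
Proof.
move=> hnrm; pose k := (m * (n + 1))%N.
pose S := [set v : 'rV[R]_k | `|v| = 1].
have cS : compact S.
  apply: bounded_closed_compact.
    by exists 1; split => // M M1 v /= ->; exact: ltW.
  apply: (@preimage_closed _ _ (@Num.norm R 'rV[R]_k) [set x | x = 1]).
    by move=> v _; exact: norm_continuous.
  exact: closed_eq.
have Sunit v : v != 0 -> S (`|v|^-1 *: v).
  by move=> v0; rewrite /S/= normrZ normfV normr_id mulVf ?normr_eq0.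
suff [c c0 cle] : exists2 c : R, 0 < c &
    forall v : 'rV[R]_k, c * `|v| <= nrm (vec_mx v).
  exists c => // u i j; rewrite -[in leRHS](mxvecK u).
  apply: le_trans (cle _); rewrite ler_pM2l// -mxvecE.
  exact: ler_coord_mx_norm.
(* The sphere is empty in dimension 0, where any constant will do. *)
have [S0|S0] := pselect (S !=set0); last first.
  exists 1 => // v; have [->|/Sunit Sv] := eqVneq v 0.
    by rewrite normr0 mulr0 is_norm_ge0.
  by exfalso; apply: S0; exists (`|v|^-1 *: v).
have [w /set_mem Sw wmin] :=
  EVT_min_rV S0 cS (continuous_subspaceT (is_norm_vec_mx_continuous hnrm)).
exists (nrm (vec_mx w)) => [|v].
  rewrite lt_neqAle is_norm_ge0// andbT eq_sym; apply/eqP => /(is_norm_eq0 hnrm).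
  move=> /(congr1 mxvec); rewrite vec_mxK linear0 => w0.
  by move/eqP: Sw; rewrite w0 normr0 eq_sym oner_eq0.
have [->|v0] := eqVneq v 0; first by rewrite normr0 mulr0 is_norm_ge0.
have /wmin := mem_set (Sunit v v0).
rewrite linearZ (is_norm_scale hnrm) normfV normr_id.
by rewrite ler_pdivlMl ?normr_gt0// mulrC.
Qed.

(** The entries of the unit ball of [nrm] are bounded, hence so is a linear form
    on it.  Without this the supremum [dual_norm_at] would be a default value. *)
Lemma dual_norm_at_has_ubound (R : realType) (m n : nat)
    (nrm : 'M[R]_(m, n + 1) -> R) (i : 'I_m) (a : 'cV[R]_(n + 1)) :
  is_norm nrm -> has_ubound [set (u *m a) i 0 | u in [set u | nrm u <= 1]].
Proof.
move=> /is_norm_dominates_entries[c c0 cle].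
exists (\sum_k c^-1 * `|a k 0|) => _ [v/= v1 <-].
rewrite mxE ler_sum// => k _; apply: le_trans (ler_norm _) _.
rewrite normrM ler_wpM2r// -[leRHS]mulr1 ler_pdivlMl//.
exact: le_trans (cle _ _ _) v1.
Qed.

Lemma dual_norm_at_ge0 (R : realType) (m n : nat)
    (nrm : 'M[R]_(m, n + 1) -> R) (i : 'I_m) (a : 'cV[R]_(n + 1)) :
  is_norm nrm -> 0 <= dual_norm_at nrm i a.
Proof.
move=> hnrm; apply: ub_le_sup; first exact: dual_norm_at_has_ubound.
by exists 0; [rewrite /= (is_norm_0 hnrm)|rewrite mul0mx mxE].
Qed.

Lemma mulmx_le_dual_norm_at (R : realType) (m n : nat)
    (nrm : 'M[R]_(m, n + 1) -> R) (i : 'I_m) (a : 'cV[R]_(n + 1)) u :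
  is_norm nrm -> (u *m a) i 0 <= dual_norm_at nrm i a * nrm u.
Proof.
move=> hnrm.
have [->|u0] := eqVneq u 0; first by rewrite mul0mx mxE (is_norm_0 hnrm) mulr0.
have nu0 : 0 < nrm u.
  rewrite lt_neqAle is_norm_ge0// andbT eq_sym.
  by apply: contra u0 => /eqP/(is_norm_eq0 hnrm) ->.
rewrite -ler_pdivrMr//; apply: ub_le_sup; first exact: dual_norm_at_has_ubound.
exists ((nrm u)^-1 *: u) => /=.
  rewrite (is_norm_scale hnrm) ger0_norm ?invr_ge0 ?is_norm_ge0 //.
  by rewrite mulVf ?lexx ?gt_eqF.
by rewrite -scalemxAl mxE mulrC.
Qed.

Lemma row_mulmx_continuous (R : realType) (m n : nat) (a : 'cV[R]_n) (i : 'I_m) :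
  continuous (fun u : 'M[R]_(m, n) => (u *m a) i 0).
Proof.
rewrite (_ : (fun _ => _) = fun u : 'M[R]_(m, n) => \sum_k u i k * a k 0).
  apply: (@continuous_big R _ +%R 0) => [|k _ u]; first exact: add_continuous.
  by apply: continuousM; [exact: coord_continuous|exact: cst_continuous].
by apply/funext => u; rewrite mxE.
Qed.

(** A finite intersection of closed half-spaces.  With [t = 0] it is the safe
    set; otherwise [t] is the margin by which every constraint is tightened. *)
Lemma measurable_row_halfspaces (R : realType) (m n : nat) (a : 'cV[R]_(n + 1))
    (t : R) (c : 'I_m -> R) :
  measurable ([set xi | forall i,
    t + ((xi : 'M[R]_(m, n + 1)) *m a) i 0 <= c i] : set (Xi R m n)).
Proof.
rewrite (_ : mkset _ = \bigcap_(i in [set: 'I_m])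
    [set xi : Xi R m n | t + ((xi : 'M[R]_(m, n + 1)) *m a) i 0 <= c i]).
  apply: fin_bigcap_measurable => // i _.
  rewrite -[X in measurable X]setCK; apply: measurableC.
  apply: sub_sigma_algebra; apply: closed_openC.
  apply: (@preimage_closed 'M[R]_(m, n + 1) R
    (fun u => t + (u *m a) i 0) [set y | y <= c i]); last exact: closed_le.
  move=> u _; apply: continuousD; first exact: cst_continuous.
  exact: row_mulmx_continuous.
by apply/seteqP; split => xi /= h i; [move=> _; exact: h|exact: h i I].
Qed.

(** Markov's inequality with a measurable event [E] but an integrand that
    is only nonnegative: the integral of a nonnegative function is the supremum of the integrals of
    the simple functions below it, and [r] times the indicator of [E] is one of
    them.  The integrand of interest is the transport cost, an arbitrary function
    on the product space, while the event is a measurable rectangle. *)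
Lemma markov_nonmeasurable d (T : measurableType d) (R : realType)
    (mu : {measure set T -> \bar R}) (f : T -> \bar R) (E : set T) (r : R) :
  measurable E -> 0 <= r -> (forall x, (0 <= f x)%E) ->
  (forall x, E x -> (r%:E <= f x)%E) ->
  (r%:E * mu E <= \int[mu]_x f x)%E.
Proof.
move=> mE r0 f0 rf; rewrite ge0_integralTE//.
apply: ereal_sup_ubound; exists (scale_nnsfun (indic_nnsfun R mE) r0) => /=.
  move=> x.
  rewrite -[measurable_realfun.mindic R mE]/(\1_E) indicE.
  have [/set_mem/rf|_] := boolP (x \in E).
    by rewrite mulr1.
  by rewrite mulr0.
by rewrite sintegralrM sintegral_indic.
Qed.

(** At least [P2 G - P1 S] of the mass arriving in [G] comes from outside [S],
    and each unit of it costs at least [r]. *)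
Lemma coupling_cost_ge_separated d (T : measurableType d) (R : realType)
    (P1 P2 : probability T R) (Q : probability (T * T)%type R)
    (f : T * T -> \bar R) (S G : set T) (r : R) :
  coupling P1 P2 Q -> measurable S -> measurable G -> 0 <= r ->
  (forall z, (0 <= f z)%E) ->
  (forall x y, ~ S x -> G y -> (r%:E <= f (x, y))%E) ->
  (r%:E * (P2 G - P1 S) <= \int[Q]_z f z)%E.
Proof.
move=> [Q1 Q2] mS mG r0 f0 rf.
have mSC := measurableC mS.
have mE : measurable (~` S `*` G) by exact: measurableX.
apply: (@le_trans _ _ (r%:E * Q (~` S `*` G))%E); last first.
  by apply: markov_nonmeasurable => // -[x y] [/= ? ?]; exact: rf.
rewrite lee_wpmul2l ?lee_fin// leeBlDr ?fin_num_measure//.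
have mS1 : measurable (fst @^-1` S : set (T * T)).
  by rewrite -[X in measurable X]setTI; exact: measurable_fst.
have mG2 : measurable (snd @^-1` G : set (T * T)).
  by rewrite -[X in measurable X]setTI; exact: measurable_snd.
rewrite -Q1// -Q2//; apply: le_trans (measureU2 _ mE mS1).
apply: le_measure; rewrite ?inE//; first exact: measurableU.
by move=> [x y]/= Gy; have [Sx|nSx] := pselect (S x); [right|left].
Qed.

Lemma wasserstein_ge_separated (R : realType) (m n : nat)
    (nrm : 'M[R]_(m, n + 1) -> R) (P1 P2 : probability (Xi R m n) R)
    (S G : set (Xi R m n)) (r : R) :
  is_norm nrm -> measurable S -> measurable G -> 0 <= r ->
  (forall x y, ~ S x -> G y ->
    r <= nrm ((x : 'M[R]_(m, n + 1)) - (y : 'M[R]_(m, n + 1)))) ->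
  (r%:E * (P2 G - P1 S) <= wasserstein nrm P1 P2)%E.
Proof.
move=> hnrm mS mG r0 rle; apply: le_ereal_inf_tmp => _ [Q cQ <-].
by apply: (coupling_cost_ge_separated cQ) => // z; rewrite lee_fin is_norm_ge0.
Qed.

Theorem theorem5 (R : realType) (n m N : nat)
    (hn : (0 < n)%N) (hm : (0 < m)%N) (hN : (0 < N)%N)
    (eps delta : R) (heps : 0 < eps < 1) (hdelta : 0 < delta)
    (eta1 eta2 : bool) (heta : (1 <= eta1 + eta2)%N)
    (B : 'I_m -> 'cV[R]_n) (b : 'I_m -> R)
    (nrm : 'M[R]_(m, n + 1) -> R) (hnrm : is_norm nrm)
    (hdual : forall (i j : 'I_m) (a : 'cV[R]_(n + 1)),
       dual_norm_at nrm i a = dual_norm_at nrm j a)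
    (zeta : 'I_N -> Xi R m n) :
  ZIset hm hN nrm eps delta zeta eta1 eta2 B b
    `<=` Zset hN nrm eps delta zeta eta1 eta2 B b.
Proof.
move=> x [alpha [alpha0 alphaeps]].
set a := avec eta1 eta2 x; set D := dual_norm hm nrm a.
set G := (X in empirical _ _ _ X) => empG.
apply: le_ereal_inf_tmp => _ [P [_ PW] <-].
set S := (X in P X).
have theta0 : 0 < eps - alpha by rewrite subr_gt0.
set r := delta / (eps - alpha).
have r0 : 0 < r by rewrite divr_gt0.
have mG : measurable G by exact: measurable_row_halfspaces.
have mS : measurable S.
  rewrite (_ : S = [set xi : Xi R m n | forall i,
    0 + ((xi : 'M[R]_(m, n + 1)) *m a) i 0 <= bfun B b i x]).
    exact: measurable_row_halfspaces.
  by apply/seteqP; split => xi /= h i; have := h i; rewrite add0r.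
have Di i : dual_norm_at nrm i a = D by exact: hdual.
have sep (u v : Xi R m n) : ~ S u -> G v ->
    r <= nrm ((u : 'M[R]_(m, n + 1)) - (v : 'M[R]_(m, n + 1))).
  move=> /existsNP[i /negP]; rewrite -ltNge => bu /(_ i) vb.
  have rD : D * r < D * nrm ((u : 'M[R]_(m, n + 1)) - (v : 'M[R]_(m, n + 1))).
    rewrite -(Di i); apply: lt_le_trans (mulmx_le_dual_norm_at i a _ hnrm).
    rewrite (Di i) mulrC mulmxBl [ltRHS]mxE [X in _ < _ + X]mxE ltrBrDr.
    exact: le_lt_trans vb bu.
  (* The strict inequality excludes D = 0, so D can be cancelled. *)
  have : 0 <= D by rewrite -(Di (Ordinal hm)) dual_norm_at_ge0.
  rewrite le_eqVlt => /predU1P[D0|D0]; first by move: rD; rewrite -D0 !mul0r ltxx.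
  by move: rD; rewrite ltr_pM2l// => /ltW.
have : (r%:E * ((1 - alpha)%:E - P S) <= delta%:E)%E.
  apply: le_trans PW.
  apply: le_trans (wasserstein_ge_separated _ _ hnrm mS mG (ltW r0) sep).
  by rewrite lee_wpmul2l ?lee_fin ?(ltW r0)// leeB.
rewrite -[P S]fineK ?fin_num_measure// -EFinB -EFinM !lee_fin.
rewrite /r mulrAC ler_pdivrMr// ler_pM2l// => le_theta.
lra.
Qed.
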